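(* Let $k \geq 2$ be an even integer and put $N = [(k-2)/6]$. For every choice of $\varepsilon_1, \ldots, \varepsilon_{N} \in \{0,1\}$, the $N$ double zeta values $$\{\zeta(2j+\varepsilon_j,\ k-2j-\varepsilon_j) \mid 1 \leq j \leq N\}$$ generate the $\mathbb{Q}$-vector space $\mathcal{DM}_k = \mathcal{DZ}_k/\mathcal{PZ}_k$; that is, every element of $\mathcal{DZ}_k$ lies in the $\mathbb{Q}$-span of these $N$ values plus $\mathcal{PZ}_k$. Consequently $\dim_{\mathbb{Q}} \mathcal{DM}_k \leq [(k-2)/6]$.
   Context: For integers $q \geq 2$, $p \geq 1$, the double zeta value is $\zeta(q,p) = \sum_{n > m > 0} n^{-q} m^{-p}$; its weight is $p+q$. For an integer $j \geq 2$, $\zeta(j) = \sum_{m\geq 1} m^{-j}$. $\mathcal{DZ}_k$ denotes the $\mathbb{Q}$-vector space spanned by all double zeta values of weight $k$. $\mathcal{PZ}_k$ denotes the $\mathbb{Q}$-vector space spanned by $\zeta(k)$ and the products $\zeta(j)\zeta(k-j)$ for $2 \leq j \leq k-2$, and $\mathcal{DM}_k = \mathcal{DZ}_k/\mathcal{PZ}_k$. $[x]$ denotes the greatest integer not exceeding $x$. *)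

(* Defs.v *)
From HB Require Import structures.
From mathcomp Require Import all_boot all_order all_algebra.
From mathcomp Require Import all_classical all_reals all_analysis.

Set Implicit Arguments.
Unset Strict Implicit.
Unset Printing Implicit Defensive.

Import Order.TTheory GRing.Theory Num.Theory.
Local Open Scope classical_set_scope.
Local Open Scope quotient_scope.
Local Open Scope ring_scope.

Section LinearSpan.
Variables (K : fieldType) (V : lmodType K).

Definition lin_span (A : set V) : set V :=
  [set v | exists s : seq (K * V),
     (forall p, p \in s -> A p.2) /\ v = \sum_(p <- s) p.1 *: p.2].

Definition lin_span_pred (A : set V) : {pred V} := fun v => v \in lin_span A.

Lemma lin_span_pred_submod_closed A : submod_closed (lin_span_pred A).
Proof.
split; first by apply/mem_set; exists [::]; split => //; rewrite big_nil.
move=> a _ _ /set_mem[s [As ->]] /set_mem[t [At ->]]; apply/mem_set.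
exists ([seq (a * p.1, p.2) | p <- s] ++ t); split=> [p|].
  by rewrite mem_cat => /orP[/mapP[q /As Aq ->]|/At].
rewrite big_cat big_map scaler_sumr; congr (_ + _).
by apply: eq_bigr => p _; rewrite scalerA.
Qed.

HB.instance Definition _ (A : set V) :=
  GRing.isSubmodClosed.Build K V (lin_span_pred A) (lin_span_pred_submod_closed A).

Definition linearly_independent n (b : 'I_n -> V) : Prop :=
  forall a : 'I_n -> K, \sum_(i < n) a i *: b i = 0 -> forall i, a i = 0.

Definition has_dim (U : set V) (n : nat) : Prop :=
  exists b : 'I_n -> V, linearly_independent b /\ lin_span (range b) = U.

End LinearSpan.

Section QuotientBySpan.
Variables (K : fieldType) (V : lmodType K) (A : set V).

Local Notation VmodA := (Quotient.quot (lin_span_pred A)).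

(* The quotient of V by the subspace lin_span A. *)
Definition quot_module : Type := VmodA.

HB.instance Definition _ := GRing.Zmodule.on quot_module.

(* Defined on the canonical representative of a class; quot_projZ shows that
   this is the scaling induced from V. *)
Definition quot_scale (a : K) (x : quot_module) : quot_module :=
  \pi_(VmodA) (a *: repr (x : VmodA)).

Definition quot_proj (v : V) : quot_module := \pi_(VmodA) v.

Lemma quot_proj_eq u v : (quot_proj u = quot_proj v) <-> (u - v \in lin_span_pred A).
Proof. by rewrite Quotient.idealrBE; split=> [/eqP|/eqP]. Qed.

Lemma quot_projD u v : quot_proj (u + v) = quot_proj u + quot_proj v.
Proof. by rewrite /quot_proj raddfD. Qed.

Lemma quot_projK (x : quot_module) :
  quot_proj (repr (x : VmodA)) = x.
Proof. exact: reprK. Qed.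

Lemma quot_projZ a v : quot_proj (a *: v) = quot_scale a (quot_proj v).
Proof.
by apply/quot_proj_eq; rewrite -scalerBr rpredZ//; apply/quot_proj_eq;
   rewrite quot_projK.
Qed.

Fact quot_scaleA a b x :
  quot_scale a (quot_scale b x) = quot_scale (a * b) x.
Proof. by rewrite -(quot_projK x) -!quot_projZ scalerA. Qed.

Fact quot_scale1 : left_id 1 quot_scale.
Proof. by move=> x; rewrite -(quot_projK x) -quot_projZ scale1r. Qed.

Fact quot_scaleDr : right_distributive quot_scale +%R.
Proof.
move=> a x y; rewrite -(quot_projK x) -(quot_projK y) -quot_projD -!quot_projZ.
by rewrite scalerDr quot_projD.
Qed.

Fact quot_scaleDl x : {morph quot_scale^~ x : a b / a + b}.
Proof.
by move=> a b; rewrite -(quot_projK x) -!quot_projZ scalerDl quot_projD.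
Qed.

HB.instance Definition _ := GRing.Zmodule_isLmodule.Build K quot_module
  quot_scaleA quot_scale1 quot_scaleDr quot_scaleDl.

End QuotientBySpan.

Section RealsOverRat.
Variable R : realType.

(* An alias of R, to carry its vector space structure over rat. *)
Definition realQ : Type := R.

HB.instance Definition _ := GRing.Zmodule.on realQ.

Definition realQ_scale (a : rat) (x : realQ) : realQ := ratr a * (x : R).

Fact realQ_scaleA a b x :
  realQ_scale a (realQ_scale b x) = realQ_scale (a * b) x.
Proof. by rewrite /realQ_scale rmorphM mulrA. Qed.

Fact realQ_scale1 : left_id 1 realQ_scale.
Proof. by move=> x; rewrite /realQ_scale rmorph1 mul1r. Qed.

Fact realQ_scaleDr : right_distributive realQ_scale +%R.
Proof. by move=> a x y; rewrite /realQ_scale mulrDr. Qed.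

Fact realQ_scaleDl x : {morph realQ_scale^~ x : a b / a + b}.
Proof. by move=> a b; rewrite /realQ_scale rmorphD mulrDl. Qed.

HB.instance Definition _ := GRing.Zmodule_isLmodule.Build rat realQ
  realQ_scaleA realQ_scale1 realQ_scaleDr realQ_scaleDl.

End RealsOverRat.

Section DoubleZeta.
Variable R : realType.

Definition zeta (j : nat) : R :=
  limn (fun n => \sum_(1 <= m < n) (m%:R : R) ^- j).

(* The sum over all pairs (n, m) with n > m > 0. It is finite when 2 <= q and
   1 <= p; these are the only arguments used below. *)
Definition dzeta (q p : nat) : R :=
  fine (\esum_(nm in [set nm : nat * nat | (0 < nm.2 < nm.1)%N])
          ((nm.1%:R : R) ^- q * (nm.2%:R : R) ^- p)%:E).

Definition dzeta_values (k : nat) : set (realQ R) :=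
  [set x | exists q p, [/\ (2 <= q)%N, (1 <= p)%N, (q + p)%N = k
                         & x = dzeta q p]].

Definition PZ_generators (k : nat) : set (realQ R) :=
  [set x | x = zeta k \/
     exists j, (2 <= j <= k - 2)%N /\ x = zeta j * zeta (k - j)].

Definition DZ (k : nat) : set (realQ R) := lin_span (dzeta_values k).

Definition PZ (k : nat) : set (realQ R) := lin_span (PZ_generators k).

Definition mod_PZ (k : nat) : realQ R -> quot_module (PZ_generators k) :=
  @quot_proj rat (realQ R) (PZ_generators k).

(* DZ k / PZ k, as a subspace of R / PZ k. PZ k is contained in DZ k when
   3 <= k; for k = 2 there are no double zeta values, so DZ 2 = DM 2 = 0. *)
Definition DM (k : nat) : set (quot_module (PZ_generators k)) :=
  mod_PZ k @` DZ k.

End DoubleZeta.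

Arguments DZ R k _ : clear implicits.
Arguments PZ R k _ : clear implicits.
Arguments DM R k _ : clear implicits.

(* Main.v *)
(* Let d = k - 2.  A rational linear form on the double zeta values that vanishes
   on PZ_k is a vector c_0, ..., c_d (c_i being the value on zeta(i+1, d-i+1), and
   c_0 = - c_d by convention), and the stuffle and shuffle products give
     c_i + c_(d-i) = 0   and   sum_i ('C(i, r) + 'C(i, d-r)) c_i = 0  (0 < r < d).
   For p = sum_i c_i X^i this means that p is anti-reciprocal and, d being even,
   that p(1 - X) = - p(X).  If p <> 0 has order v at 0, comparing the two top
   coefficients of p(1 - X) = - p(X) shows that v is odd and that c_v and c_(v+1)
   are both nonzero; so if c_(2j-1+eps_j) = 0 for all j <= N then v > 2N.  But p has
   degree d - v, a root of order v at 1 as well as at 0, and the roots -1, 2, 1/2,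
   whence 3v + 3 <= d, so 6N + 6 <= d, contradicting N = [d/6].  By duality the chosen N
   values together with PZ_k span everything. *)
Require Import Defs.
From HB Require Import structures.
From mathcomp Require Import all_boot all_order all_algebra.
From mathcomp Require Import all_classical all_reals all_analysis.
From mathcomp Require Import ring zify.
Import Order.TTheory GRing.Theory Num.Theory.
Import numFieldNormedType.Exports.
Local Open Scope classical_set_scope.
Local Open Scope ring_scope.

Set Implicit Arguments.
Unset Strict Implicit.
Unset Printing Implicit Defensive.

(** * Binomial sums and root counting for polynomials *)

(** Expand $c_i y^{d-i} (x+y)^i$ by the binomial theorem. This turns the binomial sums of the
    shuffle relations into polynomial identities. *)
Lemma sum_bin_weight (K : pzRingType) (A : comAlgType K) (d : nat) (c : nat -> K)
    (x y : A) : x + y = 1 ->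
  \sum_(r < d.+1) (\sum_(i < d.+1) 'C(i, r)%:R * c i) *: (x ^+ r * y ^+ (d - r))
  = \sum_(i < d.+1) c i *: y ^+ (d - i).
Proof.
move=> xy1; under eq_bigr => r _ do rewrite scaler_suml.
rewrite exchange_big /=; apply: eq_bigr => i _.
have le_id : (i <= d)%N by rewrite -ltnS.
transitivity (c i *: (y ^+ (d - i) * (y + x) ^+ i)); last first.
  by rewrite addrC xy1 expr1n mulr1.
rewrite exprDn mulr_sumr scaler_sumr.
rewrite (big_ord_widen d.+1 (fun j : nat =>
  c i *: (y ^+ (d - i) * (y ^+ (i - j) * x ^+ j *+ 'C(i, j))))) //.
rewrite [RHS]big_mkcond /=; apply: eq_bigr => r _; rewrite ltnS.
case: leqP => [le_ri|lt_ir]; last by rewrite bin_small ?mul0r ?scale0r.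
rewrite mulr_natl -scaler_nat -scalerAr scalerA mulr_natr.
have -> : (d - r = (d - i) + (i - r))%N by lia.
by rewrite exprD mulrCA (mulrC (x ^+ r)).
Qed.

(** Powers of $X - a$ at distinct $a$ are coprime, so their product divides [p]. *)
Lemma sum_multiplicities_lt_size (K : fieldType) (p : {poly K}) (s : seq (K * nat)) :
    p != 0 -> uniq (unzip1 s) ->
    (forall am, am \in s -> ('X - am.1%:P) ^+ am.2 %| p) ->
  (\sum_(am <- s) am.2 < size p)%N.
Proof.
move=> p0 us s_dvd.
pose P (s' : seq (K * nat)) : {poly K} := \prod_(am <- s') ('X - am.1%:P) ^+ am.2.
have P0 s' : P s' != 0.
  rewrite /P; elim: s' => [|am s' IH]; first by rewrite big_nil oner_neq0.
  by rewrite big_cons mulf_neq0 // expf_neq0 // polyXsubC_eq0.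
have sizeP : size (P s) = (\sum_(am <- s) am.2).+1.
  rewrite /P; elim: (s) => [|am s' IH]; first by rewrite !big_nil size_poly1.
  rewrite !big_cons size_mul ?P0 ?expf_neq0 ?polyXsubC_eq0 //.
  by rewrite IH size_exp_XsubC addSn addnS.
suff Pp : P s %| p by rewrite -sizeP dvdp_leq.
rewrite /P; elim: s us s_dvd {sizeP} => [|am s IH] /=; first by rewrite big_nil dvd1p.
move=> /andP[am_s us] s_dvd; rewrite big_cons Gauss_dvdp ?s_dvd ?mem_head //=.
  by apply: IH => // bn bns; rewrite s_dvd // in_cons bns orbT.
apply/coprimep_expl; rewrite coprimep_sym coprimep_XsubC.
rewrite big_seq; elim/big_ind: _ => [|q1 q2 q1a q2a|bn bns]; first by rewrite root1.
  by rewrite rootM negb_or q1a.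
case: bn bns => b [|n] bns /=; first by rewrite expr0 root1.
rewrite root_exp_XsubC; apply: contra am_s => /eqP ->.
by apply/mapP; exists (b, n.+1).
Qed.

Lemma coef_1subXn (K : comNzRingType) (i j : nat) :
  ((1 - 'X) ^+ i : {poly K})`_j = (-1) ^+ j * 'C(i, j)%:R.
Proof.
rewrite exprBn coef_sum.
under eq_bigr => l _ do
  rewrite expr1n mulr1 coefMn -[(-1) ^+ _](rmorph_sign (@polyC K)) coefCM coefXn.
case: (leqP j i) => [le_ji|lt_ij].
  rewrite (bigD1 (Ordinal (le_ji : (j < i.+1)%N))) //= eqxx mulr1 mulr_natr.
  rewrite big1 ?addr0 // => l; rewrite -val_eqE /= eq_sym => /negPf ->.
  by rewrite mulr0 mul0rn.
rewrite bin_small // mulr0 big1 // => l _.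
by rewrite gtn_eqF ?mulr0 ?mul0rn // (leq_trans (ltn_ord l)).
Qed.

(** * Solutions of the double shuffle relations as polynomials *)

Section DoubleShuffleSolutions.
Variables (K : numFieldType) (d : nat) (c : nat -> K).
Hypotheses (d_even : ~~ odd d) (d_gt0 : (0 < d)%N).
Hypothesis c_stuffle : forall i, (i <= d)%N -> c i + c (d - i) = 0.
Hypothesis c_shuffle : forall r, (0 < r < d)%N ->
  \sum_(i < d.+1) ('C(i, r) + 'C(i, d - r))%:R * c i = 0.

Let p := \poly_(i < d.+1) c i.

(** Anti-reciprocity of [p], with [e] in any module so as to cover both values of [p] and
    polynomials in $X$ or $1 - X$. *)
Lemma sum_rev (V : lmodType K) (e : nat -> V) :
  \sum_(i < d.+1) c i *: e (d - i)%N = - \sum_(i < d.+1) c i *: e i.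
Proof.
rewrite (reindex_inj rev_ord_inj) /= -sumrN; apply: eq_bigr => i _.
rewrite subSS subKn ?leq_ord // -scaleNr; congr (_ *: _).
by apply/eqP; rewrite -addr_eq0 addrC c_stuffle // leq_ord.
Qed.

Lemma horner_rev (x : K) : x != 0 -> x ^+ d * p.[x^-1] = - p.[x].
Proof.
move=> x0; rewrite !horner_poly -(sum_rev (V := K^o) (fun i => x ^+ i)) mulr_sumr.
apply: eq_bigr => i _; rewrite mulrCA exprVn; congr (_ * _).
by rewrite expfB_cond // (negPf x0) add0n leq_ord.
Qed.

(** As [d] is even, anti-reciprocity at $-1$ reads $p(-1) = -p(-1)$. *)
Lemma horner_m1 : p.[-1] = 0.
Proof.
have /horner_rev : -1 != 0 :> K by rewrite oppr_eq0 oner_neq0.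
rewrite invrN1 -signr_odd (negPf d_even) expr0 mul1r => /eqP.
by rewrite -addr_eq0 -mulr2n mulrn_eq0 => /eqP.
Qed.

(* The relation with r = 0 is not assumed: its unknown defect is s. *)
Lemma comp_poly_shuffle : exists s : K,
  p + (p \Po (1 - 'X)) = s *: ('X ^+ d + (1 - 'X) ^+ d).
Proof.
pose S r := \sum_(i < d.+1) 'C(i, r)%:R * c i.
have xy1 : 'X + (1 - 'X) = 1 :> {poly K} by rewrite addrC subrK.
have SE r : (0 < r < d)%N -> S r + S (d - r)%N = 0.
  move=> /c_shuffle <-; rewrite -big_split /=; apply: eq_bigr => i _.
  by rewrite natrD mulrDl.
exists (- (S 0%N + S d)).
have E1 := sum_bin_weight d c xy1.
have E2 := sum_bin_weight d c (etrans (addrC _ _) xy1).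
rewrite -/(S _) in E1 E2.
have pE : p = \sum_(i < d.+1) c i *: 'X ^+ i by rewrite /p poly_def.
have pcE : p \Po (1 - 'X) = \sum_(i < d.+1) c i *: (1 - 'X) ^+ i.
  rewrite pE raddf_sum /=; apply: eq_bigr => i _.
  by rewrite linearZ /= comp_Xn_poly.
rewrite sum_rev -?pE in E2.
rewrite sum_rev -?pcE in E1.
apply: oppr_inj; rewrite opprD -E1 -E2 scaleNr opprK.
(* Reversing one sum gives $X^r (1-X)^{d-r}$ the coefficient $S_{d-r} + S_r$, which is zero for $0 <
   r < d$; only the two end terms survive. *)
rewrite [X in X + _](reindex_inj rev_ord_inj) /= -big_split /=.
rewrite (eq_bigr (fun r : 'I_d.+1 => (S (d - r)%N + S r) *: ('X ^+ r * (1 - 'X) ^+ (d - r)))).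
  rewrite big_ord_recr /= subnn mulr1 -[d in X in X + _]prednK // big_ord_recl.
  rewrite subn0 expr0 mul1r big1 ?addr0 => [|i _].
    by rewrite scalerDr addrC -[nat_of_ord ord0]/0%N prednK // [S d + _]addrC.
  have /SE : (0 < lift ord0 i < d)%N by rewrite /= /bump; case: i => /=; lia.
  by move: (nat_of_ord _) => j; rewrite prednK // addrC => ->; rewrite scale0r.
move=> r _; rewrite -!/(S _) subSS subKn ?leq_ord // scalerDl.
by rewrite [(1 - 'X) ^+ _ * _]mulrC.
Qed.

(* The defect s vanishes by comparing the values of p at -1, 2 and 1/2. *)
Lemma comp_poly_anti : p \Po (1 - 'X) = - p.
Proof.
have [s Es] := comp_poly_shuffle.
have two0 : 2 != 0 :> K by rewrite pnatr_eq0.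
have E x : p.[x] + p.[1 - x] = s * (x ^+ d + (1 - x) ^+ d).
  have := congr1 (horner^~ x) Es.
  by rewrite !(hornerE, horner_comp, horner_exp).
have E2 : p.[2] = s * (1 + 2 ^+ d).
  have := E (-1); rewrite horner_m1 add0r opprK -signr_odd (negPf d_even).
  by rewrite expr0.
have Eh : 2 ^+ d * p.[2^-1] = s.
  have := E 2^-1; have -> : 1 - 2^-1 = 2^-1 :> K by field.
  move=> Ehalf; have : p.[2^-1] = s * 2^-1 ^+ d.
    by apply: (mulfI two0); rewrite mulrCA ![2 * _]mulrDl !mul1r.
  by move=> ->; rewrite mulrCA -exprMn mulfV // expr1n mulr1.
(* Anti-reciprocity at 2 reads $2^d p(1/2) = -p(2)$, that is $s = -s(1 + 2^d)$. *)
have s0 : s * (2 + 2 ^+ d) = 0.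
  have := horner_rev two0; rewrite Eh E2 => /eqP; rewrite -addr_eq0 => /eqP <-.
  by ring.
have {s0} s0 : s = 0.
  move/eqP: s0; rewrite mulf_eq0 => /orP[/eqP //|]; rewrite -[2]/(2%:R).
  by rewrite gt_eqF // addr_gt0 ?exprn_gt0 ?ltr0n.
by apply/eqP; rewrite -addr_eq0 addrC Es s0 scale0r.
Qed.

(** Coefficient of $X^j$ in $p(1-X) = -p(X)$. *)
Lemma anti_coef j : (j <= d)%N ->
  (-1) ^+ j * \sum_(i < d.+1) c i * 'C(i, j)%:R = - c j.
Proof.
move=> le_jd; have := congr1 (fun q : {poly K} => q`_j) comp_poly_anti.
rewrite coefN coef_poly ltnS le_jd => <-.
rewrite /p poly_def raddf_sum coef_sum mulr_sumr /=; apply: eq_bigr => i _.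
by rewrite linearZ /= comp_Xn_poly coefZ coef_1subXn mulrCA.
Qed.

(** By stuffle the leading coefficient of [p] is at [e = d - v]. Comparing coefficients of $X^e$ in
    $p(1-X) = -p(X)$ forces $(-1)^e = -1$. If $c_{v+1} = 0$ then $c_{e-1} = 0$, and the coefficient
    of $X^{e-1}$ gives $e c_e = 0$. *)
Lemma first_coef v : (v <= d)%N -> (forall i, (i < v)%N -> c i = 0) -> c v != 0 ->
  [/\ odd v, (v < d)%N & c v.+1 != 0].
Proof.
move=> le_vd c_lt cv0; set e := (d - v)%N.
have c_gt i : (e < i)%N -> (i <= d)%N -> c i = 0.
  by move=> ei id_; have := c_stuffle id_; rewrite (c_lt (d - i)%N) ?addr0 //; lia.
have ce0 : c e != 0.
  by apply: contra cv0 => /eqP ce0; have := c_stuffle le_vd; rewrite -/e ce0 addr0 => ->.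
have lt_ed : (e < d.+1)%N by rewrite ltnS leq_subr.
have odd_e : odd e.
  have := anti_coef (leq_subr v d : (e <= d)%N).
  rewrite (bigD1 (Ordinal lt_ed)) //= binn mulr1 big1 ?addr0 => [|i].
    rewrite -signr_odd; case: odd => //; rewrite expr0 mul1r => /eqP.
    by rewrite -addr_eq0 -mulr2n mulrn_eq0 (negPf ce0).
  rewrite -val_eqE /= neq_ltn => /orP[ie|ei]; first by rewrite bin_small ?mulr0.
  by rewrite c_gt ?mul0r // -ltnS.
have odd_v : odd v by move: odd_e; rewrite /e oddB // (negPf d_even).
have lt_vd : (v < d)%N by rewrite -subn_gt0 -/e; case: (e) odd_e.
split=> //; apply/negP => /eqP cv1.
have [e' eE] : {e' | e = e'.+1} by exists e.-1; case: (e) odd_e.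
have ce' : c e' = 0.
  by have := c_stuffle lt_vd; rewrite cv1 add0r subnS -/e eE.
have := @anti_coef e'; rewrite ce' oppr0 (bigD1 (Ordinal lt_ed)) //= big1 ?addr0 => [|i].
  rewrite eE binSn -eE => /(_ _)/eqP; rewrite mulf_eq0 signr_eq0 mulf_eq0 (negPf ce0).
  by rewrite pnatr_eq0 eE /= => /(_ _)/wrap[] //; lia.
rewrite -val_eqE /= neq_ltn => /orP[|ei]; last by rewrite c_gt ?mul0r // -ltnS.
rewrite eE ltnS leq_eqVlt => /orP[/eqP ->|ie]; first by rewrite ce' mul0r.
by rewrite bin_small ?mulr0.
Qed.

Lemma double_shuffle_vanish (eps : nat -> bool) :
  (forall j, (j < d %/ 6)%N -> c (j.*2.+1 + eps j)%N = 0) ->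
  forall i, (i <= d)%N -> c i = 0.
Proof.
move=> c_eps i le_id; apply/eqP/negPn/negP => ci0.
have ex_i : exists i, c i != 0 by exists i.
have [v cv0 v_min] := ex_minnP ex_i.
have le_vd : (v <= d)%N by rewrite (leq_trans _ le_id) ?v_min.
have c_lt l : (l < v)%N -> c l = 0.
  by move=> lv; apply/eqP/negPn/negP => /v_min; rewrite leqNgt lv.
have [odd_v lt_vd cv1] := first_coef le_vd c_lt cv0.
(* Write $v = 2j + 1$. For $j < [d/6]$ the hypothesis would kill $c_v$ or $c_{v+1}$, both
   nonzero. *)
have v_gt : (d %/ 6 <= v./2)%N.
  rewrite leqNgt; apply/negP => /c_eps; have -> : v./2.*2.+1 = v.
    by have := odd_double_half v; rewrite odd_v.
  by case: (eps _); rewrite ?addn0 ?addn1 => /eqP; apply/negP.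
have p0 : p != 0.
  apply: contra cv0 => /eqP /(congr1 (fun q : {poly K} => q`_v)).
  by rewrite coef0 coef_poly ltnS le_vd => ->.
(* Vanishing below [v] mirrors to vanishing above [d - v]. As [v] is odd, hence positive, the bound
   is $d - v + 1$. *)
have size_p : (size p <= d - v.-1)%N.
  apply/leq_sizeP => l le_l; rewrite coef_poly; case: ltnP => // ld.
  by have := @c_stuffle l ld; rewrite (c_lt (d - l)%N) ?addr0 //; move: odd_v; lia.
have Xv_p : 'X^v %| p.
  have take0 : take_poly v p = 0.
    apply/polyP => l; rewrite coef_take_poly coef0 coef_poly.
    by case: ltnP => // /c_lt ->; case: ifP.
  by rewrite -(poly_take_drop v p) take0 add0r dvdp_mull.
have X1v_p : ('X - 1%:P) ^+ v %| p.
  have := dvdp_comp_poly (1 - 'X) Xv_p; rewrite comp_poly_anti comp_Xn_poly dvdpNr.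
  by apply: dvdp_trans; rewrite -[1 - 'X]opprB exprNn dvdp_mull.
have pm1 := horner_m1.
have p_refl x : p.[1 - x] = - p.[x].
  have := congr1 (horner^~ x) comp_poly_anti.
  by rewrite !(hornerE, horner_comp).
(* The reflection $x \mapsto 1 - x$ takes $-1$ to $2$ and fixes $1/2$, where therefore $p = -p$. *)
have p2 : p.[2] = 0 by have := p_refl (-1); rewrite pm1 oppr0 opprK.
have ph : p.[2^-1] = 0.
  have := p_refl 2^-1; have -> : 1 - 2^-1 = 2^-1 :> K by field.
  by move/eqP; rewrite -addr_eq0 -mulr2n mulrn_eq0 => /eqP.
pose rs : seq (K * nat) := [:: (0, v); (1, v); (-1, 1%N); (2, 1%N); (2^-1, 1%N)].
have dvd_rs am : am \in rs -> ('X - am.1%:P) ^+ am.2 %| p.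
  rewrite !inE => /or4P[||| /orP[]] /eqP-> /=;
    by rewrite ?expr1 ?subr0 // dvdp_XsubCl; apply/rootP.
have half_lt1 : 2^-1 < 1 :> K by rewrite invf_lt1 ?ltr0n ?ltr1n.
have m1_lt (x : K) : 0 < x -> (-1 == x) = false.
  by move=> x0; rewrite lt_eqF // (lt_trans _ x0) // oppr_lt0.
have uniq_rs : uniq (unzip1 rs).
  rewrite /= !inE !m1_lt ?invr_gt0 ?ltr0n // ![0 == _]eq_sym oppr_eq0 invr_eq0.
  rewrite oner_eq0 pnatr_eq0 /= [1 == -1]eq_sym m1_lt ?ltr01 //.
  by rewrite (lt_eqF (ltr1n K 2)) (gt_eqF half_lt1) (gt_eqF (lt_trans half_lt1 _)) ?ltr1n //=.
(* This gives $2v + 3 < d - v + 1$, so $3v + 3 \le d$, whereas $v \ge 2[d/6] + 1$ gives $3v + 3 \ge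
   6[d/6] + 6 > d$. *)
have := sum_multiplicities_lt_size p0 uniq_rs dvd_rs.
rewrite !big_cons big_nil /=.
move=> /leq_trans /(_ size_p); have := odd_double_half v; rewrite odd_v.
by move: v_gt lt_vd; lia.
Qed.
End DoubleShuffleSolutions.

(** * Linear spans, duality and dimension *)

Section Spans.
Variables (K : fieldType) (V : lmodType K).
Implicit Types A B : set V.

Lemma lin_spanP A v : (v \in lin_span_pred A) <-> lin_span A v.
Proof. by split=> [/set_mem|/mem_set]. Qed.

Lemma sub_lin_span A : A `<=` lin_span A.
Proof.
move=> v Av; exists [:: (1, v)]; split=> [p|]; first by rewrite inE => /eqP ->.
by rewrite big_seq1 scale1r.
Qed.

Lemma lin_span_min A B : A `<=` lin_span B -> lin_span A `<=` lin_span B.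
Proof.
move=> AB _ [s [As ->]]; apply/lin_spanP; rewrite big_seq.
by apply: rpred_sum => p ps; apply/rpredZ/lin_spanP/AB/As.
Qed.

Lemma lin_spanS A B : A `<=` B -> lin_span A `<=` lin_span B.
Proof. by move=> AB; apply: lin_span_min => v /AB /sub_lin_span. Qed.

Lemma lin_spanU A B v : lin_span (A `|` B) v ->
  exists a b, [/\ lin_span A a, lin_span B b & v = a + b].
Proof.
move=> [s [ABs ->]]; elim: s ABs => [|p s IH] ABs.
  exists 0, 0; rewrite big_nil addr0.
  by split=> //; apply/lin_spanP; apply: rpred0.
have [|a [b [Aa Bb sE]]] := IH; first by move=> q qs; apply: ABs; rewrite inE qs orbT.
rewrite big_cons sE; case: (ABs p (mem_head _ _)) => [Ap|Bp].
  exists (p.1 *: p.2 + a), b; rewrite addrA; split=> //.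
  by apply/lin_spanP/rpredD; [apply/rpredZ/lin_spanP/sub_lin_span|apply/lin_spanP].
exists a, (p.1 *: p.2 + b); rewrite addrCA; split=> //.
by apply/lin_spanP/rpredD; [apply/rpredZ/lin_spanP/sub_lin_span|apply/lin_spanP].
Qed.

End Spans.

Section SpanMaps.
Variables (K : fieldType) (V : lmodType K).
Implicit Types A : set V.

Lemma lin_span_image (W : lmodType K) (f : {linear V -> W}) A :
  lin_span (f @` A) = f @` lin_span A.
Proof.
apply/seteqP; split=> [_ [s [As ->]]|_ [_ [s [As ->]] <-]].
  elim: s As => [|p s IH] As.
    by exists 0; rewrite ?big_nil ?linear0 //; apply/lin_spanP; apply: rpred0.
  have [|v Av vE] := IH; first by move=> q qs; apply: As; rewrite inE qs orbT.
  have [u Au uE] := As p (mem_head _ _).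
  exists (p.1 *: u + v); last by rewrite linearP big_cons vE uE.
  by apply/lin_spanP/rpredD; [apply/rpredZ/lin_spanP/sub_lin_span|apply/lin_spanP].
rewrite linear_sum; apply/lin_spanP; rewrite big_seq; apply: rpred_sum => p ps.
by rewrite linearZ; apply/rpredZ/lin_spanP/sub_lin_span; exists p.2; [apply: As|].
Qed.

(** A matrix of relations with trivial kernel has full column rank, hence a left inverse [B]; row
    [j] of [B] writes [w j] as a combination of the vectors assumed to lie in the span. *)
Lemma lin_span_dual n (I : finType) (r : I -> 'I_n -> K) (w : 'I_n -> V) A :
    (forall i, lin_span A (\sum_(j < n) r i j *: w j)) ->
    (forall c : 'I_n -> K, (forall i, \sum_(j < n) r i j * c j = 0) ->
       forall j, c j = 0) ->
  forall j, lin_span A (w j).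
Proof.
move=> rw_A r_inj j; pose M := \matrix_(i < #|I|, j < n) r (enum_val i) j.
have /row_fullP[B BM] : row_full M.
  (* Each column of [cokermx M] solves all the relations, so it is zero. *)
  rewrite -cokermx_eq0; apply/eqP/matrixP => l i; rewrite [RHS]mxE.
  apply: (r_inj (fun l => cokermx M l i)) => x.
  have /matrixP/(_ (enum_rank x) i) := mulmx_coker M.
  rewrite mxE [RHS]mxE => E; rewrite -[RHS]E.
  by apply: eq_bigr => k _; rewrite [M _ _]mxE enum_rankK.
have -> : w j = \sum_(i < #|I|) B j i *: \sum_(l < n) r (enum_val i) l *: w l.
  under eq_bigr => i _ do rewrite scaler_sumr.
  rewrite exchange_big /= (bigD1 j) //= [X in _ + X]big1 ?addr0 => [|l lj].
    under eq_bigr => i _ do rewrite scalerA.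
    rewrite -scaler_suml -[LHS]scale1r; congr (_ *: _).
    have /matrixP/(_ j j) := BM; rewrite mxE [RHS]mxE eqxx => E; rewrite -[LHS]E.
    by apply: eq_bigr => i _; rewrite [M _ _]mxE.
  under eq_bigr => i _ do rewrite scalerA.
  rewrite -scaler_suml -[RHS](scale0r (w l)); congr (_ *: _).
  have /matrixP/(_ j l) := BM; rewrite mxE [RHS]mxE eq_sym (negPf lj) => E; rewrite -[RHS]E.
  by apply: eq_bigr => i _; rewrite [M _ _]mxE.
by apply/lin_spanP/rpred_sum => i _; apply/rpredZ/lin_spanP.
Qed.

(** A generating family of least length is independent: in a nontrivial relation, a vector with
    nonzero coefficient could be dropped. *)
Lemma lin_span_has_dim n (b : 'I_n -> V) :
  exists d, (d <= n)%N /\ has_dim (lin_span (range b)) d.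
Proof.
pose P d := `[< exists b' : 'I_d -> V, lin_span (range b') = lin_span (range b) >].
have exP : exists d, P d by exists n; apply/asboolP; exists b.
have [d /asboolP[b' b'E] d_min] := ex_minnP exP.
exists d; split; first by apply: d_min; apply/asboolP; exists b.
exists b'; split=> // a a0 i; apply/eqP/negPn/negP => ai0.
case: d => [|d] in b' b'E d_min a a0 i ai0 *; first by case: i ai0.
suff /d_min : P d by rewrite ltnn.
apply/asboolP; exists (b' \o lift i); rewrite -b'E; apply/seteqP; split.
  by apply: lin_spanS => _ [j _ <-]; exists (lift i j).
apply: lin_span_min => _ [j _ <-]; case: (unliftP i j) => [l ->|->].
  by apply: sub_lin_span; exists l.
have -> : b' i = \sum_(l < d) (- (a i)^-1 * a (lift i l)) *: b' (lift i l).
  apply: (scalerI ai0); rewrite scaler_sumr.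
  move/eqP: a0; rewrite (bigD1_ord i) //= addr_eq0 => /eqP ->.
  rewrite -sumrN; apply: eq_bigr => l _.
  by rewrite scalerA mulrA mulrN mulfV // mulN1r scaleNr.
apply/lin_spanP/rpred_sum => l _; apply/rpredZ/lin_spanP/sub_lin_span.
by exists l.
Qed.

(** Linearity of [quot_proj] lets [lin_span_image] carry spans to the quotient. *)
HB.instance Definition _ A := GRing.isLinear.Build K V (quot_module A) *:%R
  (@quot_proj K V A) (fun a u v =>
    etrans (quot_projD A (a *: u) v) (congr1 (+%R^~ (quot_proj A v)) (quot_projZ A a u))).
End SpanMaps.

(** * Unordered sums in the extended reals *)

Lemma esum_natmul (R : realType) (T : choiceType) (S : set T) (a : T -> \bar R) n :
  (forall t, S t -> (0 <= a t)%E) ->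
  \esum_(t in S) (a t *+ n)%E = ((\esum_(t in S) a t) *+ n)%E.
Proof.
move=> a0; elim: n => [|n IH]; first by rewrite esum1.
rewrite muleS -IH -esumD //; first by apply: eq_esum => t _; rewrite muleS.
by move=> t /a0 at0; elim: n {IH} => // n IH; rewrite muleS adde_ge0.
Qed.

Lemma reindex_esum_can (R : realType) (T T' : choiceType) (P : set T) (Q : set T')
    (e : T -> T') (g : T' -> T) (a : T' -> \bar R) :
    (forall t, P t -> Q (e t) /\ g (e t) = t) ->
    (forall t, Q t -> P (g t) /\ e (g t) = t) ->
  \esum_(t in Q) a t = \esum_(t in P) a (e t).
Proof.
move=> Pe Qg; apply: reindex_esum.
split=> [t /Pe[]//|t t' /set_mem/Pe[_ gt] /set_mem/Pe[_ gt'] E|].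
  by rewrite -gt E gt'.
by move=> t /Qg[Pgt eg]; exists (g t).
Qed.

(** * Partial fractions for the shuffle product *)

Section PartialFractions.
Variables (A : comNzRingType) (z : A).

(** One half of the expansion, with a factor $zy$ taken out; the recursions below reflect Pascal's
    rule. *)
Let F r s (y : A) := \sum_(i < (r + s).+1) (z ^+ i * y ^+ (r + s - i)) *+ 'C(i, r).

Let F0S s y : F 0 s.+1 y = y ^+ s.+1 + z * F 0 s y.
Proof.
rewrite /F big_ord_recl /= expr0 mul1r subn0 bin0 mulr1n; congr (_ + _).
by rewrite mulr_sumr; apply: eq_bigr => i _; rewrite !bin0 !mulr1n exprS mulrA.
Qed.

Let FS0 r y : F r.+1 0 y = z * F r 0 y.
Proof.
rewrite /F big_ord_recl /= bin0n mulr0n add0r mulr_sumr.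
rewrite !addn0; apply: eq_bigr => i _; rewrite binS bin_small ?add0n //.
by rewrite -!mulrnAr exprS -mulrA subSS.
Qed.

Let FSS r s y : F r.+1 s.+1 y = z * (F r.+1 s y + F r s.+1 y).
Proof.
rewrite /F big_ord_recl /= bin0n mulr0n add0r (addSnnS r s) -big_split /= mulr_sumr.
apply: eq_bigr => i _; rewrite binS -mulrnDr -mulrnAr -[(r.+1 + s.+1 - _)%N]/(r + s.+1 - i)%N.
by rewrite exprS -mulrA mulrnAr.
Qed.

(* Applied to x = 1/m, y = 1/n, z = 1/(m + n). *)
Lemma partial_fractions r s (x y : A) : x * y = z * (x + y) ->
  x ^+ r.+1 * y ^+ s.+1 =
  \sum_(i < (r + s).+1) (z ^+ i.+1 * y ^+ (r + s - i).+1) *+ 'C(i, r) +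
  \sum_(i < (r + s).+1) (z ^+ i.+1 * x ^+ (r + s - i).+1) *+ 'C(i, s).
Proof.
(* The boundary $r = 0$ of the double induction; exchanging the variables gives the boundary $s =
   0$. *)
have F0 s' x' y' : x' * y' = z * (x' + y') ->
    x' * y' ^+ s'.+1 = z * (y' * F 0 s' y' + x' * F s' 0 x').
  move=> xy; elim: s' => [|s' IH].
    by rewrite /F !big_ord1 /= !mulr1n mul1r !mulr1 expr1 [y' + _]addrC.
  have -> : x' * y' ^+ s'.+2 = z * y' ^+ s'.+2 + z * (x' * y' ^+ s'.+1).
    transitivity (x' * y' * y' ^+ s'.+1); first by rewrite (exprS y' s'.+1) mulrA.
    by rewrite xy -mulrA mulrDl mulrDr -exprS addrC.
  by rewrite IH F0S FS0 (exprS y' s'.+1); ring.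
(* Replacing one factor $xy$ by $z(x+y)$ lowers one exponent at a time, which is the recursion [FSS]
   of [F]. *)
have FE : x * y = z * (x + y) ->
    x ^+ r.+1 * y ^+ s.+1 = z * (y * F r s y + x * F s r x).
  move=> xy; elim: r s => [|r' IH] s'; first by rewrite expr1 F0.
  elim: s' => [|s' IHs].
    by rewrite expr1 mulrC F0 1?addrC // mulrC xy addrC.
  have -> : x ^+ r'.+2 * y ^+ s'.+2 = z * (x ^+ r'.+2 * y ^+ s'.+1 + x ^+ r'.+1 * y ^+ s'.+2).
    rewrite (exprS x r'.+1) (exprS y s'.+1).
    transitivity (x * y * (x ^+ r'.+1 * y ^+ s'.+1)); first by ring.
    by rewrite xy; ring.
  by rewrite IHs IH !FSS; ring.
move=> /FE ->; rewrite mulrDr !mulrA /F !mulr_sumr (addnC s r).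
congr (_ + _); apply: eq_bigr => i _; rewrite mulrnAr; congr (_ *+ _).
  by rewrite !exprS; ring.
by rewrite !exprS; ring.
Qed.
End PartialFractions.

(** * Convergence, stuffle and shuffle products of zeta values *)

Section ZetaSeries.
Variable R : realType.

Let pos : set nat := [set m | (0 < m)%N].

Let u (j n : nat) : R := \sum_(1 <= m < n) (m%:R : R) ^- j.

Lemma inv_exp_ge0 (m j : nat) : 0 <= (m%:R : R) ^- j.
Proof. by rewrite invr_ge0 exprn_ge0. Qed.

(** Telescoping: $(n+2)^{-j} \le 1/((n+1)(n+2)) = 1/(n+1) - 1/(n+2)$. *)
Let u_le2 j n : (2 <= j)%N -> u j n.+2 <= 2 - n.+1%:R^-1.
Proof.
move=> j2; elim: n => [|n IH].
  by rewrite /u big_nat1 expr1n !invr1 lerBrDr.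
rewrite /u big_nat_recr //=; apply: (le_trans (lerD IH (lexx _))).
have n1 : 0 < n.+1%:R :> R by rewrite ltr0n.
have n2 : 0 < n.+2%:R :> R by rewrite ltr0n.
suff h : n.+2%:R ^- j <= n.+1%:R^-1 - n.+2%:R^-1 :> R.
  by rewrite -addrA lerD2l addrC lerBlDr addrC.
apply: (@le_trans _ _ ((n.+1%:R * n.+2%:R)^-1)).
  rewrite lef_pV2 ?posrE ?mulr_gt0 ?exprn_gt0 //.
  apply: (@le_trans _ _ (n.+2%:R ^+ 2)).
    by rewrite expr2 ler_pM2r // ler_nat.
  by apply: ler_weXn2l => //; rewrite ler1n.
rewrite le_eqVlt; apply/orP; left; apply/eqP.
rewrite -[n.+2]addn1 natrD; field.
by rewrite -natr1 in n2 *; rewrite !gt_eqF // natr1 -natrD addn1.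
Qed.

Let u_homo j : {homo u j : n m / (n <= m)%N >-> n <= m}.
Proof.
apply: homo_leq => [//|? ? ?|[|n]]; first exact: le_trans.
  by rewrite /u !big_geq.
by rewrite /u [leRHS]big_nat_recr //= lerDl inv_exp_ge0.
Qed.

Let u_cvg j : (2 <= j)%N -> cvgn (u j).
Proof.
move=> j2; apply: nondecreasing_is_cvgn; first exact: u_homo.
exists 2 => _ [n _ <-]; apply: (@le_trans _ _ (u j n.+2)); first by apply: u_homo; lia.
by apply: (le_trans (u_le2 n j2)); rewrite gerBl invr_ge0.
Qed.

(** Passing to unordered sums of nonnegative terms makes splitting and reindexing unconditional. *)
Lemma zeta_esum j : (2 <= j)%N ->
  (zeta R j)%:E = \esum_(m in pos) ((m%:R : R) ^- j)%:E.
Proof.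
move=> j2; rewrite /zeta -EFin_lim; last exact: u_cvg.
rewrite -(nneseries_esum (P := fun m => (0 < m)%N)) => [|m _]; last first.
  by rewrite lee_fin inv_exp_ge0.
congr (limn _); apply/funext => n /=; rewrite -sumEFin.
case: n => [|n]; first by rewrite !big_geq.
by rewrite [RHS]big_ltn_cond //= big_nat_cond [RHS]big_nat_cond; apply: eq_bigl => i; lia.
Qed.

(** Tonelli: each factor is moved inside the other sum, then [esum_esum] merges the nested sums. *)
Lemma zeta_mul_esum r s : (2 <= r)%N -> (2 <= s)%N ->
  (zeta R r * zeta R s)%:E =
  \esum_(p in [set p : nat * nat | (0 < p.1)%N /\ (0 < p.2)%N])
    ((p.1%:R : R) ^- r * (p.2%:R : R) ^- s)%:E.
Proof.
move=> r2 s2; have esumE (a : nat -> R) : (forall m, 0 <= a m) ->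
    \esum_(m in pos) (a m)%:E = (\sum_(m <oo | (0 < m)%N) (a m)%:E)%E.
  by move=> a0; rewrite nneseries_esum // => m _; rewrite lee_fin.
have esumZ (c : R) (a : nat -> R) : 0 <= c -> (forall m, 0 <= a m) ->
    (c%:E * \esum_(m in pos) (a m)%:E)%E = \esum_(m in pos) (c * a m)%:E.
  move=> c0 a0; rewrite !esumE // => [|m]; last by rewrite mulr_ge0.
  by rewrite -nneseriesZl // => m _; rewrite lee_fin.
have zs0 : 0 <= zeta R s.
  by rewrite -lee_fin zeta_esum // esum_ge0 // => m _; rewrite lee_fin inv_exp_ge0.
rewrite mulrC EFinM (zeta_esum r2) esumZ //.
rewrite (eq_esum (b := fun m => \esum_(n in pos) ((m%:R : R) ^- r * (n%:R : R) ^- s)%:E)).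
  rewrite (esum_esum (J := fun=> pos)
    (a := fun m n => ((m%:R : R) ^- r * (n%:R : R) ^- s)%:E)) //.
by move=> m _; rewrite mulrC EFinM zeta_esum // esumZ ?inv_exp_ge0.
Qed.

(** The double zeta value before [fine], possibly infinite. The products are computed with it first,
    and finiteness is then drawn from the stuffle product. *)
Let D (a b : nat) : \bar R :=
  \esum_(nm in [set nm : nat * nat | (0 < nm.2 < nm.1)%N])
    ((nm.1%:R : R) ^- a * (nm.2%:R : R) ^- b)%:E.

Let D_ge0 a b : (0 <= D a b)%E.
Proof. by apply: esum_ge0 => p _; rewrite lee_fin mulr_ge0 ?inv_exp_ge0. Qed.

(** The quadrant splits into two open halves and the diagonal, where the exponents add up. *)
Let stuffle_esum r s : (2 <= r)%N -> (2 <= s)%N ->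
  (zeta R r * zeta R s)%:E = (D r s + (D s r + (zeta R (r + s))%:E))%E.
Proof.
move=> r2 s2; rewrite zeta_mul_esum //.
set Q := [set p | _]; set f := (X in esum _ X).
have f0 p : (0 <= f p)%E by rewrite lee_fin mulr_ge0 ?inv_exp_ge0.
rewrite (esumID [set p : nat * nat | (p.2 < p.1)%N]) //.
rewrite [X in (_ + X)%E](esumID [set p : nat * nat | (p.1 < p.2)%N]) //.
congr (_ + (_ + _))%E.
- congr (esum _ _); apply/seteqP; split=> -[m n] /=; rewrite /Q /=; lia.
- rewrite [RHS](reindex_esum_can (P := Q `&` ~` [set p | (p.2 < p.1)%N]
      `&` [set p | (p.1 < p.2)%N])
      (e := fun p => (p.2, p.1)) (g := fun p => (p.2, p.1))).
  + by apply: eq_esum => p _; rewrite mulrC.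
  + by move=> [m n]; rewrite /Q /setI /setC /= => mn; split; [lia|].
  + by move=> [m n]; rewrite /Q /setI /setC /= => mn; split; [lia|].
rewrite zeta_esum ?(leq_trans r2) ?leq_addr //.
rewrite [RHS](reindex_esum_can (P := Q `&` ~` [set p | (p.2 < p.1)%N]
      `&` ~` [set p | (p.1 < p.2)%N])
      (e := fun p => p.1) (g := fun m => (m, m))).
- apply: eq_esum => -[m n]; rewrite /Q /setI /setC /= => mn.
  have -> : n = m by lia.
  by rewrite exprD invfM.
- by move=> [m n]; rewrite /Q /pos /setI /setC /= => mn; split; [lia|congr (_, _); lia].
- by move=> m; rewrite /Q /setI /setC /pos /=; split; [lia|].
Qed.

(** Apply partial fractions with $z = 1/(m+n)$ to each term; $(m,n) \mapsto (m+n,n)$ and $(m,n)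
    \mapsto (m+n,m)$ are bijections from the quadrant onto the summation region of [D]. *)
Let shuffle_esum r s : (0 < r)%N -> (0 < s)%N ->
  (zeta R r.+1 * zeta R s.+1)%:E =
  (\sum_(i < (r + s).+1) D i.+1 (r + s - i).+1 *+ 'C(i, r) +
   \sum_(i < (r + s).+1) D i.+1 (r + s - i).+1 *+ 'C(i, s))%E.
Proof.
move=> r0 s0; rewrite zeta_mul_esum //.
pose z (p : nat * nat) : R := (p.1 + p.2)%:R^-1.
pose F (p : nat * nat) (x : R) i := z p ^+ i.+1 * x ^+ (r + s - i).+1.
have F0 p (n i : nat) : 0 <= F p n%:R^-1 i.
  by rewrite mulr_ge0 ?exprn_ge0 ?invr_ge0.
have EF0 p (n i j : nat) : (0 <= (F p n%:R^-1 i)%:E *+ j)%E.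
  by rewrite -EFin_natmul lee_fin mulrn_wge0.
rewrite (eq_esum (b := fun p : nat * nat =>
    (\sum_(i < (r + s).+1) (F p p.2%:R^-1 i)%:E *+ 'C(i, r) +
     \sum_(i < (r + s).+1) (F p p.1%:R^-1 i)%:E *+ 'C(i, s))%E)); last first.
  move=> [m n] /= [m0 n0]; rewrite -!exprVn (partial_fractions (z := z (m, n))).
    rewrite EFinD -!sumEFin; congr (_ + _)%E; apply: eq_bigr => i _;
      by rewrite EFin_natmul.
  have m0' : m%:R != 0 :> R by rewrite pnatr_eq0 -lt0n.
  have n0' : n%:R != 0 :> R by rewrite pnatr_eq0 -lt0n.
  have mn0 : m%:R + n%:R != 0 :> R by rewrite -natrD pnatr_eq0 -lt0n addn_gt0 m0.
  by rewrite /z natrD; field; rewrite m0' n0' mn0.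
rewrite esumD; first last.
- by move=> p _; apply: sume_ge0.
- by move=> p _; apply: sume_ge0.
rewrite !esum_sum //; congr (_ + _)%E; apply: eq_bigr => i _;
  rewrite esum_natmul => [|p _]; rewrite ?lee_fin //; congr (_ *+ _)%E.
- rewrite [RHS](reindex_esum_can (P := [set p : nat * nat | (0 < p.1)%N /\ (0 < p.2)%N])
      (e := fun p => (p.1 + p.2, p.2)%N) (g := fun p => (p.1 - p.2, p.2)%N)).
  + by apply: eq_esum => p _; rewrite /F /z !exprVn.
  + by move=> [m n] /= mn; split; [lia|congr (_, _); lia].
  + by move=> [m n] /= mn; split; [lia|congr (_, _); lia].
rewrite [RHS](reindex_esum_can (P := [set p : nat * nat | (0 < p.1)%N /\ (0 < p.2)%N])
      (e := fun p => (p.1 + p.2, p.1)%N) (g := fun p => (p.2, p.1 - p.2)%N)).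
- by apply: eq_esum => p _; rewrite /F /z !exprVn.
- by move=> [m n] /= mn; split; [lia|congr (_, _); lia].
- by move=> [m n] /= mn; split; [lia|congr (_, _); lia].
Qed.

(** For $b \ge 2$ the stuffle product bounds [D a b] by $\zeta(a)\zeta(b)$. For $b = 1$ the weight
    condition gives $a \ge 3$, which allows comparison with [D a.-1 2]. *)
Let D_fin a b : (2 <= a)%N -> (1 <= b)%N -> (4 <= a + b)%N -> D a b = (dzeta R a b)%:E.
Proof.
move=> a2 b1 ab4; rewrite /dzeta fineK // -/(D a b).
have D_lt r s : (2 <= r)%N -> (2 <= s)%N -> (D r s < +oo)%E.
  move=> r2 s2; apply: le_lt_trans (ltry (zeta R r * zeta R s)).
  rewrite (stuffle_esum r2 s2) leeDl // adde_ge0 // zeta_esum; last by lia.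
  by apply: esum_ge0 => m _; rewrite lee_fin inv_exp_ge0.
rewrite ge0_fin_numE //; case: (ltnP 1 b) => [|b1']; first exact: D_lt.
have -> : b = 1%N by lia.
have a3 : (3 <= a)%N by lia.
(* As m < n, n^-a m^-1 <= n^-(a-1) m^-2. *)
apply: (@le_lt_trans _ _ (D a.-1 2)); last by apply: D_lt; lia.
apply: le_esum => -[n m] /= /andP[m0 mn]; rewrite lee_fin -(prednK (ltnW a2)).
have m0' : 0 < m%:R :> R by rewrite ltr0n.
have n0' : 0 < n%:R :> R by rewrite ltr0n (ltn_trans m0).
rewrite exprSr invfM -mulrA; apply: ler_wpM2l; first exact: inv_exp_ge0.
rewrite expr1 expr2 invfM; apply: ler_wpM2r; first by rewrite invr_ge0 ltW.
by rewrite lef_pV2 // ler_nat ltnW.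
Qed.

Lemma stuffle r s : (2 <= r)%N -> (2 <= s)%N ->
  zeta R r * zeta R s = dzeta R r s + dzeta R s r + zeta R (r + s).
Proof.
move=> r2 s2; apply: EFin_inj; rewrite stuffle_esum // !D_fin //; try by lia.
by rewrite -!EFinD addrA.
Qed.

Lemma shuffle r s : (0 < r)%N -> (0 < s)%N ->
  zeta R r.+1 * zeta R s.+1 =
  \sum_(i < (r + s).+1) ('C(i, r) + 'C(i, s))%:R * dzeta R i.+1 (r + s - i).+1.
Proof.
move=> r0 s0; apply: EFin_inj; rewrite shuffle_esum //.
have DE j i : (0 < j)%N -> (i < (r + s).+1)%N ->
    (D i.+1 (r + s - i).+1 *+ 'C(i, j))%E
    = ('C(i, j)%:R * dzeta R i.+1 (r + s - i).+1)%:E.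
  (* For $i < j$ the binomial is zero; this covers $i = 0$, where [D] is infinite. *)
  move=> j0 irs; case: (ltnP i j) => [ij|ji]; first by rewrite bin_small // mule0n mul0r.
  by rewrite D_fin -?EFin_natmul ?mulr_natl //; lia.
rewrite -big_split /= -sumEFin; apply: eq_bigr => i _.
by rewrite !DE // natrD mulrDl EFinD.
Qed.
End ZetaSeries.

(** * Generation of the double zeta space and the dimension bound *)

(** Duality: [lin_span_dual] reduces generation to the uniqueness statement
    [double_shuffle_vanish]. *)
Lemma DZ_sub_lin_span (R : realType) (d : nat) (eps : nat -> bool) (A : set (realQ R)) :
    ~~ odd d -> @PZ_generators R d.+2 `<=` A ->
    (forall j, (j < d %/ 6)%N -> A (dzeta R (j.*2.+2 + eps j) (d.+1 - (j.*2.+1 + eps j)))) ->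
  DZ R d.+2 `<=` lin_span A.
Proof.
move=> d_even PZ_A z_A; apply: lin_span_min => _ [q [p [q2 p1 qp ->]]].
have d_gt0 : (0 < d)%N by lia.
(* Index 0 would be the divergent zeta(1, d + 1); it gets the value that stuffle
   antisymmetry forces. *)
pose w (i : 'I_d.+1) : realQ R :=
  if (i : nat) == 0%N then - dzeta R d.+1 1 else dzeta R i.+1 (d - i).+1.
(* Three blocks of rows: stuffle relations, shuffle relations, and unit vectors at the chosen
   values. *)
pose rel (x : 'I_d.+1 + 'I_d.+1 + 'I_(d %/ 6)) (j : 'I_d.+1) : rat :=
  match x with
  | inl (inl i) => (j == i)%:R + (j == rev_ord i)%:R
  | inl (inr t) => if (0 < t < d)%N then ('C(j, t) + 'C(j, d - t))%:R else 0
  | inr l => (j == inord (l.*2.+1 + eps l))%:R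
  end.
have sum_delta (V : lmodType rat) (v : 'I_d.+1 -> V) i :
    \sum_j (j == i)%:R *: v j = v i.
  rewrite (bigD1 i) //= eqxx scale1r big1 ?addr0 // => j /negPf ->.
  by rewrite scale0r.
have ltN l : (l < d %/ 6)%N -> (l.*2.+1 + eps l < d.+1)%N.
  by case: (eps l); lia.
have q_lt : (q.-1 < d.+1)%N by lia.
have -> : dzeta R q p = w (Ordinal q_lt).
  by rewrite /w /=; case: eqP; [lia|move=> _; congr (dzeta R _ _); lia].
apply: (lin_span_dual (r := rel)) => [[[i|t]|l]|c relc].
- rewrite /rel; under eq_bigr => j _ do rewrite scalerDl.
  rewrite big_split /= !sum_delta /w /= subSS subn_eq0.
  (* At $i = 0$ and $i = d$ the two terms cancel by the choice of [w] at 0; in between their sum is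
     $\zeta(i+1)\zeta(d-i+1) - \zeta(d+2)$. *)
  have le_id := ltn_ord i; case: eqP => [->|i0] /=.
    rewrite leqNgt d_gt0 /= !subn0 subnn addNr.
    by apply/lin_spanP; apply: rpred0.
  case: leqP => [le_di|lt_id].
    have -> : (i : nat) = d by lia.
    by rewrite subnn subrr; apply/lin_spanP; apply: rpred0.
  have zA : lin_span A (zeta R i.+1 * zeta R (d - i).+1 - zeta R d.+2 : R).
    apply/lin_spanP/rpredB; apply/lin_spanP/sub_lin_span/PZ_A; last by left.
    right; exists i.+1; split; first by lia.
    by congr (_ * zeta R _); lia.
  rewrite subKn ?(ltnW lt_id) //; move: zA; rewrite stuffle; try by lia.
  by rewrite (_ : (i.+1 + (d - i).+1 = d.+2)%N) ?addrK //; lia.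
- rewrite /rel; case tP: (0 < t < d)%N; last first.
    by rewrite big1 => [|j _]; [apply/lin_spanP/rpred0|rewrite scale0r].
  have [t0 td] := andP tP.
  have zA : lin_span A (zeta R t.+1 * zeta R (d - t).+1 : R).
    apply/sub_lin_span/PZ_A; right; exists t.+1; split; first by lia.
    by congr (_ * zeta R _); lia.
  move: zA; rewrite shuffle ?subn_gt0 // subnKC ?(ltnW td) //; congr (lin_span A _).
  apply: eq_bigr => j _; rewrite /w /=.
  (* At $j = 0$ both binomials vanish because $0 < t < d$, so the substitute value of [w] does not
     disturb the shuffle relation. *)
  case: eqP => [->|_]; last by rewrite /GRing.scale /= /realQ_scale ratr_nat.
  by rewrite !bin0n !gtn_eqF ?subn_gt0 //= mul0r scale0r.
- rewrite sum_delta /w inordK ?ltN //=; apply: sub_lin_span.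
  by rewrite -subSn; [exact: z_A|rewrite -ltnS ltN].
pose c' i := c (inord i).
have relc' (x : 'I_d.+1 + 'I_d.+1 + 'I_(d %/ 6)) : \sum_(j < d.+1) rel x j * c' j = 0.
  by rewrite -[RHS](relc x); apply: eq_bigr => j _; rewrite /c' inord_val.
have c_stuffle i : (i <= d)%N -> c' i + c' (d - i)%N = 0.
  move=> le_id; have := relc' (inl (inl (inord i))).
  rewrite /rel; under eq_bigr => j _ do rewrite mulrDl.
  rewrite big_split /= !(sum_delta rat^o (fun j : 'I_d.+1 => c' j)) /=.
  by rewrite subSS inordK.
have c_shuffle t : (0 < t < d)%N -> \sum_(i < d.+1) ('C(i, t) + 'C(i, d - t))%:R * c' i = 0.
  move=> td; have := relc' (inl (inr (inord t))); rewrite /rel inordK ?td //.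
  by case/andP: td => _ /ltnW.
move=> j; rewrite -[j]inord_val -/(c' j).
apply: (double_shuffle_vanish d_even d_gt0 c_stuffle c_shuffle (eps := eps)).
  move=> l lN; have := relc' (inr (Ordinal lN)).
  by rewrite /rel (sum_delta rat^o (fun j : 'I_d.+1 => c' j)) /= inordK ?ltN.
by rewrite -ltnS.
Qed.

Theorem theorem1 (R : realType) (k : nat) (k_ge2 : (2 <= k)%N)
    (k_even : ~~ odd k) :
  let N := ((k - 2) %/ 6)%N in
  (forall eps : 'I_N -> bool,
     let z := (fun i : 'I_N =>
       dzeta R (2 * i.+1 + eps i) (k - 2 * i.+1 - eps i)) : 'I_N -> realQ R in
     lin_span (range (fun i => mod_PZ k (z i))) = DM R k /\
     (forall x, DZ R k x ->
        exists u v, [/\ lin_span (range z) u, PZ R k v & x = u + v])) /\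
  (exists d, (d <= N)%N /\ has_dim (DM R k) d).
Proof.
move=> N.
have decomp (eps : 'I_N -> bool) (z := (fun i : 'I_N =>
      dzeta R (2 * i.+1 + eps i) (k - 2 * i.+1 - eps i)) : 'I_N -> realQ R) x :
    DZ R k x -> exists u v, [/\ lin_span (range z) u, PZ R k v & x = u + v].
  (* [eps'] extends [eps] by [false] from the ordinals below [N] to all naturals. *)
  move=> DZx; apply: lin_spanU; pose eps' j := oapp eps false (insub j).
  have kE : k = (k - 2).+2 by lia.
  move: DZx; rewrite {1}kE; apply: (DZ_sub_lin_span (eps := eps')); rewrite -?kE.
  - by rewrite oddB // (negPf k_even).
  - by move=> y; right.
  move=> j jN; left; exists (Ordinal jN) => //; rewrite /z /eps' insubT /=.
  by congr (dzeta R _ _); case: (eps _); rewrite /N in jN *; lia.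
have spanDM (eps : 'I_N -> bool) (z := (fun i : 'I_N =>
      dzeta R (2 * i.+1 + eps i) (k - 2 * i.+1 - eps i)) : 'I_N -> realQ R) :
    lin_span (range (fun i => mod_PZ k (z i))) = DM R k.
  have -> : range (fun i => mod_PZ k (z i)) = quot_proj (@PZ_generators R k) @` range z.
    by rewrite image_comp.
  rewrite lin_span_image; apply/seteqP; split=> _ [x xz <-].
    exists x => //; apply: lin_spanS xz => _ [i _ <-].
    exists (2 * i.+1 + eps i)%N, (k - 2 * i.+1 - eps i)%N.
    (* From $6(i+1) \le k - 2$ the truncated difference in the second argument is at least 1. *)
    by split=> //; have := ltn_ord i; rewrite {2}/N; case: (eps i); lia.
  have [u [v [zu PZv ->]]] := decomp eps x xz.
  by exists u => //; apply/esym/quot_proj_eq; rewrite addrC addKr; apply/lin_spanP.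
split=> [eps|]; first by split; [exact: spanDM|exact: decomp].
(* Any single choice of [eps] gives the dimension bound. *)
rewrite -(spanDM (fun=> false)); exact: lin_span_has_dim.
Qed.
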